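(* Let $X(t)$, $t\ge 0$, be a finite homogeneous continuous-time Markov chain on $\{0,1,\dots,S\}$ with regular infinitesimal matrix $Q$. Suppose that one of the following holds: (I) $X(t)$ is a birth-death process with all birth rates $\lambda_i$ and death rates $\mu_{i+1}$, $0\le i\le S-1$, positive; (II) $X(t)$ is a Markov chain with batch births and single deaths, with all $\mu_{i+1}$, $0\le i\le S-1$, positive and $a_2<a_1$; (III) $X(t)$ is a Markov chain with batch deaths and single births, with all $\lambda_i$, $0\le i\le S-1$, positive and $b_2<b_1$; (IV) $X(t)$ is a Markov chain with batch births and batch deaths, with $a_2<a_1$ and $b_2<b_1$. Then there exist positive numbers $d_1,\dots,d_S$ such that, with $D=\mathrm{diag}(d_1,\dots,d_S)$ and $B^{**}=DTBT^{-1}D^{-1}=(b^{**}_{ij})_{i,j=1}^S$, the quantities $$h^{**}=\max_{1\le k\le S}\sum_{i=1}^S b^{**}_{ik},\qquad h_{**}=\min_{1\le k\le S}\sum_{i=1}^S b^{**}_{ik}$$ satisfy $h^{**}=h_{**}$, and hence every solution $\mathbf w(t)$ of $\frac{d}{dt}\mathbf w(t)=B^{**}\mathbf w(t)$ with (coordinatewise) non-negative initial condition $\mathbf w(0)$ satisfies $$\|\mathbf w(t)\|=\exp\{h_{**}t\}\,\|\mathbf w(0)\|\quad\text{for all } t\ge 0,$$ where $\|\cdot\|$ is the $l_1$-norm, $\|\mathbf x\|=\sum_i|x_i|$.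
   Context: $Q=(q_{i,j})_{i,j=0}^S$ is the (time-independent) infinitesimal matrix of $X(t)$: $q_{i,j}\ge 0$ for $i\neq j$ and $q_{i,i}=-\sum_{j\ne i}q_{i,j}$. Put $A=Q^T=(a_{i,j})_{i,j=0}^S$, i.e. $a_{i,j}=q_{j,i}$. Regularity: the infinitesimal matrix is called regular (the chain is said to have the regular structure of the infinitesimal matrix) if, for every fixed $i\in\{0,\dots,S\}$, both $q_{i-k,i}$ (for $1\le k\le i$) and $q_{i+k,i}$ (for $1\le k\le S-i$) decrease in $k$, where ''decrease'' is in the non-strict sense (non-increasing). The four classes of chains (off-diagonal entries of $A$; all indices range over values for which the entries are defined): (I) Birth-death process: $a_{ij}=0$ if $|i-j|>1$; $a_{i,i+1}=\mu_{i+1}$ (death rates) and $a_{i+1,i}=\lambda_i$ (birth rates). (II) Chain with batch births and single deaths: $a_{ij}=0$ if $i<j-1$; $a_{i+k,i}=a_k$ for $k\ge 1$ (rate of birth of a group of $k$ particles, not depending on $i$), $a_{i,i+1}=\mu_{i+1}$ (death rate); and $a_{k+1}\le a_k$ for all $k\ge 1$. (III) Chain with batch deaths and single births: $a_{ij}=0$ if $i>j+1$; $a_{i,i+k}=b_k$ for $k\ge 1$ (rate of death of a group of $k$ particles, not depending on $i$), $a_{i+1,i}=\lambda_i$ (birth rate); and $b_{k+1}\le b_k$ for all $k\ge 1$. (IV) Chain with batch births and batch deaths: $a_{i+k,i}=a_k$ and $a_{i,i+k}=b_k$ for $k\ge 1$ (rates of birth and of death of a group of $k$ particles, not depending on $i$);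 and $a_{k+1}\le a_k$, $b_{k+1}\le b_k$ for all $k\ge 1$. Conditions involving $a_2$ or $b_2$ presuppose $S\ge 2$. $B$ is the $S\times S$ matrix with entries $b_{ij}=a_{ij}-a_{i0}$, $1\le i,j\le S$ (the double-indexed $b_{ij}$ are not to be confused with the death rates $b_k$). It is the matrix of the reduced system obtained from the forward Kolmogorov system $\frac{d}{dt}\mathbf p(t)=A\mathbf p(t)$ by substituting $p_0(t)=1-\sum_{i=1}^S p_i(t)$, where $p_i(t)=P\{X(t)=i\}$. Solutions $\mathbf w$ of $\frac{d}{dt}\mathbf w=B^{**}\mathbf w$ are exactly the functions $\mathbf w(t)=DT\mathbf y(t)$ with $\frac{d}{dt}\mathbf y(t)=B\mathbf y(t)$. $T$ is the $S\times S$ upper triangular matrix with all entries on and above the main diagonal equal to $1$ and all entries below it equal to $0$. *)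

(* Defs.v *)
From HB Require Import structures.
From mathcomp Require Import all_boot all_order all_algebra.
From mathcomp Require Import all_classical all_reals all_analysis.

Set Implicit Arguments.
Unset Strict Implicit.
Unset Printing Implicit Defensive.

Import Order.TTheory GRing.Theory Num.Theory.
Import numFieldNormedType.Exports.

Local Open Scope classical_set_scope.
Local Open Scope ring_scope.

(* The state space {0, ..., S} is 'I_S.+1. Vectors and
   matrices indexed by 1, ..., S are indexed by 'I_S, the mathematical index
   i + 1 being represented by i : 'I_S, i.e. by the state lift ord0 i. *)

Definition infinitesimal_matrix (R : realType) (S : nat)
    (Q : 'M[R]_S.+1) : Prop :=
  (forall i j, i != j -> 0 <= Q i j) /\
  (forall i, Q i i = - \sum_(j | j != i) Q i j).

Definition stochastic_matrix (R : realType) (n : nat) (M : 'M[R]_n) : Prop :=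
  (forall i j, 0 <= M i j) /\ (forall i, \sum_j M i j = 1).

(* p t i j is the probability of moving from i to j in time t; only the values
   of p on [0, +oo[ matter. *)
Definition transition_function (R : realType) (S : nat)
    (Q : 'M[R]_S.+1) (p : R -> 'M[R]_S.+1) : Prop :=
  [/\ p 0 = 1%:M,
      forall t : R, 0 <= t -> stochastic_matrix (p t),
      forall s t : R, 0 <= s -> 0 <= t -> p (s + t) = p s *m p t &
      forall i j, h^-1 * (p h i j - (i == j)%:R) @[h --> 0^'+] --> Q i j].

(* The Markov property is written in multiplied-out form, which avoids
   conditioning on events of probability 0: for 0 <= t_0 <= ... <= t_(n+1),
     P(X(t_0) = x_0, ..., X(t_(n+1)) = x_(n+1))
       = P(X(t_0) = x_0, ..., X(t_n) = x_n) * p_(x_n, x_(n+1))(t_(n+1) - t_n).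
   *)
Definition homogeneous_markov_chain (R : realType) (S : nat)
    (d : measure_display) (Omega : measurableType d) (P : probability Omega R)
    (X : R -> Omega -> 'I_S.+1) (Q : 'M[R]_S.+1) : Prop :=
  (forall (t : R) i, 0 <= t -> measurable (X t @^-1` [set i])) /\
  exists p : R -> 'M[R]_S.+1, transition_function Q p /\
    forall (n : nat) (t : nat -> R) (x : nat -> 'I_S.+1),
      0 <= t 0%N -> (forall k, (k <= n)%N -> t k <= t k.+1) ->
      P [set om | forall k, (k <= n.+1)%N -> X (t k) om = x k] =
      (P [set om | forall k, (k <= n)%N -> X (t k) om = x k] *
       (p (t n.+1 - t n) (x n) (x n.+1))%:E)%E.

(* For each i, both k |-> q_(i-k,i) and k |-> q_(i+k,i) are non-increasing in
   k >= 1; here j and l stand for the states i -/+ k, so that j, being at least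
   as far from i as l, corresponds to the larger k. *)
Definition regular_infinitesimal_matrix (R : realType) (S : nat)
    (Q : 'M[R]_S.+1) : Prop :=
  forall i : 'I_S.+1,
    (forall j l : 'I_S.+1, (j <= l)%N -> (l < i)%N -> Q j i <= Q l i) /\
    (forall j l : 'I_S.+1, (i < l)%N -> (l <= j)%N -> Q j i <= Q l i).

(* In the four classes A is the transpose of the infinitesimal matrix, so A i j
   is the rate from j to i. Of the rate sequences only lam_0, ..., lam_(S-1) and
   mu_1, ..., mu_S, a_1, ..., a_S, b_1, ..., b_S matter. *)
Definition birth_death (R : realType) (S : nat) (A : 'M[R]_S.+1)
    (lam mu : nat -> R) : Prop :=
  [/\ forall i j : 'I_S.+1, (i.+1 < j)%N || (j.+1 < i)%N -> A i j = 0,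
      forall i j : 'I_S.+1, j = i.+1 :> nat -> A i j = mu i.+1 &
      forall i j : 'I_S.+1, j = i.+1 :> nat -> A j i = lam i].

Definition nonincreasing_rates (R : realType) (S : nat) (a : nat -> R) : Prop :=
  forall k : nat, (1 <= k)%N -> (k.+1 <= S)%N -> a k.+1 <= a k.

Definition batch_births_single_deaths (R : realType) (S : nat)
    (A : 'M[R]_S.+1) (a mu : nat -> R) : Prop :=
  [/\ forall i j : 'I_S.+1, (i.+1 < j)%N -> A i j = 0,
      forall (i j : 'I_S.+1) (k : nat),
        (1 <= k)%N -> j = (i + k)%N :> nat -> A j i = a k,
      forall i j : 'I_S.+1, j = i.+1 :> nat -> A i j = mu i.+1 &
      nonincreasing_rates S a].

Definition batch_deaths_single_births (R : realType) (S : nat)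
    (A : 'M[R]_S.+1) (b lam : nat -> R) : Prop :=
  [/\ forall i j : 'I_S.+1, (j.+1 < i)%N -> A i j = 0,
      forall (i j : 'I_S.+1) (k : nat),
        (1 <= k)%N -> j = (i + k)%N :> nat -> A i j = b k,
      forall i j : 'I_S.+1, j = i.+1 :> nat -> A j i = lam i &
      nonincreasing_rates S b].

Definition batch_births_batch_deaths (R : realType) (S : nat)
    (A : 'M[R]_S.+1) (a b : nat -> R) : Prop :=
  [/\ forall (i j : 'I_S.+1) (k : nat),
        (1 <= k)%N -> j = (i + k)%N :> nat -> A j i = a k,
      forall (i j : 'I_S.+1) (k : nat),
        (1 <= k)%N -> j = (i + k)%N :> nat -> A i j = b k,
      nonincreasing_rates S a &
      nonincreasing_rates S b].

Definition reduced_matrix (R : realType) (S : nat) (A : 'M[R]_S.+1) :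
    'M[R]_S :=
  \matrix_(i, j) (A (lift ord0 i) (lift ord0 j) - A (lift ord0 i) ord0).

Definition upper_ones (R : realType) (S : nat) : 'M[R]_S :=
  \matrix_(i, j) (i <= j)%N%:R.

Definition Bstar2 (R : realType) (S : nat) (Q : 'M[R]_S.+1) (d : 'rV[R]_S) :
    'M[R]_S :=
  diag_mx d *m upper_ones R S *m reduced_matrix Q^T
    *m invmx (upper_ones R S) *m invmx (diag_mx d).

Definition column_sum (R : realType) (S : nat) (M : 'M[R]_S) (k : 'I_S) : R :=
  \sum_(i < S) M i k.

(* The value at the first column is only the default of the iterated maximum
   (resp. minimum); the hypothesis 0 < S makes that column exist. *)
Definition max_column_sum (R : realType) (S : nat) (S_gt0 : (0 < S)%N)
    (M : 'M[R]_S) : R :=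
  \big[Num.max/column_sum M (Ordinal S_gt0)]_(k < S) column_sum M k.

Definition min_column_sum (R : realType) (S : nat) (S_gt0 : (0 < S)%N)
    (M : 'M[R]_S) : R :=
  \big[Num.min/column_sum M (Ordinal S_gt0)]_(k < S) column_sum M k.

(* w is differentiable on [0, +oo[ (from the right at 0) with w' = M w; the
   values of w outside [0, +oo[ play no role. *)
Definition linear_ode_solution (R : realType) (S : nat) (M : 'M[R]_S)
    (w : R -> 'cV[R]_S) : Prop :=
  forall (t : R) (i : 'I_S), 0 <= t ->
    (s - t)^-1 * (w s i 0 - w t i 0)
      @[s --> within [set s : R | 0 <= s] t^'] --> (M *m w t) i 0.

Definition l1norm (R : realType) (S : nat) (x : 'cV[R]_S) : R :=
  \sum_(i < S) `|x i 0|.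

(* Main.v *)
Require Import Defs.
From HB Require Import structures.
From mathcomp Require Import all_boot all_order all_algebra.
From mathcomp Require Import all_classical all_reals all_analysis.
From mathcomp Require Import zify ring.

Set Implicit Arguments.
Unset Strict Implicit.
Unset Printing Implicit Defensive.

Import Order.TTheory GRing.Theory Num.Theory.
Import numFieldNormedType.Exports.

Local Open Scope classical_set_scope.
Local Open Scope ring_scope.

(* The (i, k) entry of T B T^-1 is the sum over states m >= i of
   q_(k,m) - q_(k-1,m); since the rows of Q sum to 0, it is also the sum over
   m < i of q_(k-1,m) - q_(k,m). Regularity makes the first form non-negative
   for i > k and the second for i < k, and each of the four classes makes the
   entries next to the diagonal positive. So T B T^-1 is an irreducible matrix
   with non-negative off-diagonal entries, and by Perron-Frobenius it has a
   positive left eigenvector d with real eigenvalue h. With D = diag(d) this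
   says that every column of B^** sums to h. Solutions of w' = B^** w starting
   in the positive orthant stay there, so ||w|| = sum_i w_i, which satisfies
   ||w||' = h ||w||. *)

(** * Perron-Frobenius theory for left eigenvectors *)

Lemma mulmx_row_gt0 (R : realType) n (x : 'rV[R]_n) (M : 'M[R]_n) :
  (forall i, 0 <= x 0 i) -> x != 0 -> (forall i j, 0 < M i j) ->
  forall j, 0 < (x *m M) 0 j.
Proof.
move=> x0 xN0 M0 j; rewrite mxE.
have h i : true -> 0 <= x 0 i * M i j by rewrite mulr_ge0 // ltW.
rewrite lt_neqAle sumr_ge0 // andbT eq_sym.
apply: contraNneq xN0 => /eqP; rewrite psumr_eq0 // => /allP s0.
apply/eqP/rowP => i; rewrite mxE; apply/eqP.
by have := s0 i (mem_index_enum _); rewrite mulf_eq0 (gt_eqF (M0 _ _)) orbF.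
Qed.

Section PerronFrobenius.
Variables (R : realType) (n : nat) (M : 'M[R]_n.+1).
Hypothesis M_ge0 : forall i j, 0 <= M i j.

(** The Collatz-Wielandt quotient, the minimum of [(x M)_j / x_j], need not be continuous where
    coordinates of [x] vanish. The set of pairs below it is still compact, so the largest [r] is
    attained. *)
Let feasible : set (R * 'rV[R]_n.+1) :=
  [set rx : R * 'rV[R]_n.+1 |
    [/\ 0 <= rx.1, forall i, 0 <= rx.2 0 i, \sum_i rx.2 0 i = 1 &
        forall j, rx.1 * rx.2 0 j <= (rx.2 *m M) 0 j]].

Let feasible_bounded :
  feasible `<=` `[0, \sum_i \sum_j M i j] `*`
    [set v : 'rV[R]_n.+1 | forall i, `[0, 1]%classic (v ord0 i)].
Proof.
move=> [r x] [/= r0 x0 x1 rx].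
have xle1 i : x 0 i <= 1.
  by rewrite -x1 (bigD1 i) //= lerDl sumr_ge0.
split => /=; last by move=> i; rewrite in_itv /= x0 xle1.
(* Since the coordinates of [x] sum to 1, adding the inequalities over [j] bounds [r]. *)
rewrite in_itv /= r0 /= -[r]mulr1 -x1 mulr_sumr.
apply: (le_trans (ler_sum _ (fun j _ => rx j))).
under [leLHS]eq_bigr do rewrite mxE.
rewrite exchange_big /=; apply: ler_sum => i _; apply: ler_sum => j _.
by rewrite ler_piMl.
Qed.

Let feasible_closed : closed feasible.
Proof.
have cfst : continuous (fun rx : R * 'rV[R]_n.+1 => rx.1).
  by move=> rx; exact: cvg_fst.
have csnd i : continuous (fun rx : R * 'rV[R]_n.+1 => rx.2 0 i).
  move=> rx; apply: (@continuous_comp _ _ _ snd (fun v : 'rV[R]_n.+1 => v 0 i)).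
    exact: cvg_snd.
  exact: coord_continuous.
(* The weights [f] cover both the normalisation, with [f = 1], and the coordinates of [x M]. *)
have csum (f : 'I_n.+1 -> R) :
    continuous (fun rx : R * 'rV[R]_n.+1 => \sum_i rx.2 0 i * f i).
  elim: (index_enum _) => [|i l IH].
    rewrite (_ : (fun _ => _) = cst 0); first exact: cst_continuous.
    by apply/funext => rx; rewrite big_nil.
  rewrite (_ : (fun _ => _) = (fun rx : R * 'rV[R]_n.+1 => rx.2 0 i * f i) \+
     (fun rx => \sum_(j <- l) rx.2 0 j * f j)).
    by move=> rx; apply: cvgD (IH rx); apply: cvgMr_tmp; exact: csnd.
  by apply/funext => rx; rewrite big_cons.
have closed_nneg (f : R * 'rV[R]_n.+1 -> R) :
    continuous f -> closed [set rx | 0 <= f rx].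
  by move/continuous_closedP/(_ _ (@closed_ge _ 0)).
pose T := (R * 'rV[R]_n.+1)%type.
rewrite (_ : feasible =
  ([set rx : T | 0 <= rx.1] `&` \bigcap_i [set rx : T | 0 <= rx.2 0 i] `&`
   [set rx : T | \sum_i rx.2 0 i * 1 = 1] `&`
   \bigcap_j [set rx : T | 0 <= \sum_i rx.2 0 i * M i j - rx.1 * rx.2 0 j])).
  apply: closedI; [apply: closedI; [apply: closedI|]|].
  - exact: closed_nneg.
  - by apply: closed_bigI => i _; exact: closed_nneg.
  - have /continuous_closedP := csum (fun=> 1).
    by move/(_ _ (@closed_eq _ 1)).
  - apply: closed_bigI => j _; apply: closed_nneg => rx.
    apply: cvgB; first exact: csum.
    by apply: cvgM; [exact: cfst | exact: csnd].
apply/seteqP; split => [[r x] [/= r0 x0 x1 rx]|[r x] [[[/= r0 x0] x1] rx]].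
  split => [|j _ /=]; last by rewrite subr_ge0; have := rx j; rewrite mxE.
  split; last by under eq_bigr do rewrite mulr1.
  by split => // i _; exact: x0.
split => //=.
- by move=> i; exact: x0.
- by rewrite -x1; under [RHS]eq_bigr do rewrite mulr1.
- by move=> j; rewrite -subr_ge0 mxE; exact: rx.
Qed.

Let feasible_neq0 : feasible !=set0.
Proof.
exists (0, const_mx (n.+1%:R^-1)); split => //=.
- by move=> i; rewrite mxE.
- under eq_bigr do rewrite mxE.
  by rewrite sumr_const card_ord -[LHS]mulr_natr mulVf // pnatr_eq0.
- by move=> j; rewrite mul0r mxE sumr_ge0 // => i _; rewrite mxE mulr_ge0.
Qed.

(* Collatz-Wielandt: if [r] is the largest number with [r x <= x M] for some
   nonzero [x >= 0], then equality holds, since otherwise applying [M ^+ k]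
   would make the inequality strict in every coordinate. *)
Lemma left_perron_vector (k : nat) :
  (forall i j, 0 < (M ^+ k) i j) ->
  exists (d : 'rV[R]_n.+1) (r : R), (forall i, 0 < d 0 i) /\ d *m M = r *: d.
Proof.
move=> Mk_gt0.
have feasible_compact : compact feasible.
  apply: subclosed_compact feasible_closed _ feasible_bounded.
  apply: (compact_setX (@segment_compact R _ _)).
  apply: (@rV_compact R _ (fun=> `[0, 1]%classic)) => i.
  exact: segment_compact.
have [|[r x]] := compact_EVT_max (f := fst) feasible_neq0 feasible_compact.
  by apply: continuous_subspaceT => rx; exact: cvg_fst.
rewrite inE => -[/= r0 x0 x1 rx] r_max.
have xN0 : x != 0.
  apply/eqP => xE; move: x1; rewrite xE big1 => [/esym/eqP|i _]; last first.
    by rewrite mxE.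
  by rewrite oner_eq0.
have MkM : M *m M ^+ k = M ^+ k *m M by rewrite -[LHS]exprS -[RHS]exprSr.
have y_gt0 := mulmx_row_gt0 x0 xN0 Mk_gt0.
set y := x *m M ^+ k in y_gt0.
exists y, r; split => //.
suff /eqP xM : x *m M - r *: x == 0.
  by rewrite /y -mulmxA -MkM mulmxA (subr0_eq xM) -scalemxAl.
apply: contraT => zN0.
have z0 i : 0 <= (x *m M - r *: x) 0 i.
  by have := rx i; rewrite -subr_ge0 !mxE.
have u_gt0 := mulmx_row_gt0 z0 zN0 Mk_gt0.
set u := _ *m _ in u_gt0.
have uE : u = y *m M - r *: y.
  by rewrite /u mulmxBl -mulmxA MkM mulmxA -scalemxAl.
(* The largest [e <= 1] with [e y <= u]; it makes [r + e] feasible for the normalised [y], against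
   the maximality of [r]. *)
pose e := \big[Order.min/1]_j (u 0 j / y 0 j).
have e_gt0 : 0 < e.
  apply/bigmin_gtP; split => [|i _]; first exact: ltr01.
  by rewrite divr_gt0.
pose s := \sum_i y 0 i.
have s_gt0 : 0 < s.
  by rewrite /s (bigD1 ord0) //= ltr_wpDr // sumr_ge0 // => i _; rewrite ltW.
suff /r_max /= : (r + e, s^-1 *: y) \in feasible.
  by rewrite gerDl leNgt e_gt0.
rewrite inE; split => /=.
- by rewrite addr_ge0 // ltW.
- by move=> i; rewrite mxE mulr_ge0 ?invr_ge0 //; exact: ltW.
- under eq_bigr do rewrite mxE.
  by rewrite -mulr_sumr mulVf // gt_eqF.
- move=> j; rewrite -scalemxAl !mxE mulrCA ler_pM2l ?invr_gt0 //.
  have : e * y 0 j <= u 0 j.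
    by rewrite -ler_pdivlMr //; apply: bigmin_le_cond.
  by rewrite uE !mxE mulrDl lerBrDl.
Qed.

End PerronFrobenius.

(** The entry sums the weights of all [k]-step walks from [i] to [j], and a walk with steps of
    length at most 1 has positive weight. *)
Lemma banded_exp_gt0 (R : realDomainType) n (M : 'M[R]_n.+1) :
  (forall i j, 0 <= M i j) ->
  (forall i j : 'I_n.+1, (i <= j.+1)%N -> (j <= i.+1)%N -> 0 < M i j) ->
  forall (k : nat) (i j : 'I_n.+1),
    (i <= j + k)%N -> (j <= i + k)%N -> 0 < (M ^+ k) i j.
Proof.
move=> M_ge0 M_gt0; elim=> [|k IH] i j ij ji.
  by rewrite expr0 mxE -val_eqE /= eqn_leq -(addn0 j) ij addn0 -(addn0 i) ji.
have Mk_ge0 i' j' : 0 <= (M ^+ k) i' j'.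
  elim: (k) i' j' => [|l IHl] i' j'; first by rewrite expr0 mxE ler0n.
  by rewrite exprSr mxE sumr_ge0 // => m _; rewrite mulr_ge0.
(* The last state before [j] on such a walk: one step from [j] towards [i], or [j] itself if they
   coincide. *)
have [l [il li lj jl]] : exists l : 'I_n.+1,
    [/\ (i <= l + k)%N, (l <= i + k)%N, (l <= j.+1)%N & (j <= l.+1)%N].
  have [i_lt_j|j_lt_i|ij_eq] := ltngtP i j.
  - have j1_lt : (j.-1 < n.+1)%N by case: (i) (j) i_lt_j => ? ? [] /=; lia.
    by exists (Ordinal j1_lt); split => /=; lia.
  - have j1_lt : (j.+1 < n.+1)%N by case: (i) (j) j_lt_i => ? ? [] /=; lia.
    by exists (Ordinal j1_lt); split => /=; lia.
  - by exists j; split; lia.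
rewrite exprSr mxE (bigD1 l) //= ltr_wpDr //.
  by rewrite sumr_ge0 // => m _; rewrite mulr_ge0.
by rewrite mulr_gt0 ?IH ?M_gt0.
Qed.

(** Adding [c] times the identity keeps the eigenvectors and makes the diagonal positive, so that a
    power of the shifted matrix is positive. *)
Lemma metzler_left_perron_vector (R : realType) n (M : 'M[R]_n) :
  (0 < n)%N -> (forall i j, i != j -> 0 <= M i j) ->
  (forall i j : 'I_n, i.+1 = j -> 0 < M i j /\ 0 < M j i) ->
  exists (d : 'rV[R]_n) (r : R), (forall i, 0 < d 0 i) /\ d *m M = r *: d.
Proof.
case: n M => // n M _ M_ge0 M_gt0.
pose c := 1 + \sum_i `|M i i|.
pose N := M + c%:M.
have N_diag i : 0 < N i i.
  rewrite !mxE eqxx mulr1n -ltrBlDl sub0r /c.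
  have : - M i i <= \sum_i `|M i i|.
    by rewrite (bigD1 i) //= ler_wpDr ?sumr_ge0 // -normrN ler_norm.
  by move=> /le_lt_trans; apply; rewrite ltrDr.
have N_off i j : i != j -> N i j = M i j.
  by move=> ij; rewrite !mxE (negbTE ij) mulr0n addr0.
have N_ge0 i j : 0 <= N i j.
  by have [->|ij] := eqVneq i j; [exact: ltW | rewrite N_off ?M_ge0].
have N_gt0 (i j : 'I_n.+1) : (i <= j.+1)%N -> (j <= i.+1)%N -> 0 < N i j.
  move=> ij ji; have [->//|i_neq_j] := eqVneq i j.
  rewrite N_off //; move: i_neq_j; rewrite -val_eqE /= => i_neq_j.
  have [i_lt_j|j_lt_i|ij_eq] := ltngtP i j; last by lia.
  - by apply: (proj1 (M_gt0 i j _)); lia.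
  - by apply: (proj2 (M_gt0 j i _)); lia.
(* The matrix now has size [n + 1], so indices differ by at most [n] and the [n]-th power
   suffices. *)
have [|d [r [d_gt0 dN]]] := left_perron_vector N_ge0 (k := n).
  move=> i j; apply: banded_exp_gt0 => //.
    by have := ltn_ord i; lia.
  by have := ltn_ord j; lia.
exists d, (r - c); split => //.
rewrite scalerBl -dN mulmxDr -addrA [X in _ + X](_ : _ = 0) ?addr0 //.
by rewrite mul_mx_scalar subrr.
Qed.

(** * Calculus for solutions of the linear system *)

Section LinearSystem.
Variables (R : realType) (n : nat) (M : 'M[R]_n) (w : R -> 'cV[R]_n).
Hypothesis w_sol : linear_ode_solution M w.

(** Caratheodory's criterion is applied to the difference quotient completed by its limit. Near
    [t > 0] all times are non-negative, so the one-sided restriction disappears. *)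
Lemma linear_ode_is_derive (t : R) (i : 'I_n) : 0 < t ->
  is_derive t 1 (fun s => w s i 0) ((M *m w t) i 0).
Proof.
move=> t0; apply/is_derive1_caratheodory.
exists (fun s => if s == t then (M *m w t) i 0
                 else (s - t)^-1 * (w s i 0 - w t i 0)); split.
- move=> s; have [->|st] := eqVneq s t; first by rewrite !subrr mulr0.
  by rewrite mulrAC mulVf ?mul1r // subr_eq0.
- apply/continuous_withinNx; rewrite eqxx => U /(w_sol (ltW t0)) /= qU.
  have {}qU : \forall s \near t^',
      0 <= s -> U ((s - t)^-1 * (w s i 0 - w t i 0)).
    exact: qU.
  have s_ge0 : \forall s \near t^', 0 <= s.
    by apply: nbhs_dnbhs; by apply: filterS (lt_nbhsr t0) => s /ltW.
  rewrite near_simpl; apply: filterS3 qU s_ge0 (nbhs_dnbhs_neq t).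
  by move=> s /= + s0 st => /(_ s0); rewrite (negbTE st).
- by rewrite eqxx.
Qed.

Lemma linear_ode_cvg_at_right0 (i : 'I_n) : w s i 0 @[s --> 0^'+] --> w 0 i 0.
Proof.
have q0 : (s - 0)^-1 * (w s i 0 - w 0 i 0) @[s --> 0^'+] --> (M *m w 0) i 0.
  move=> U /(w_sol (lexx 0)) /=.
  rewrite /at_right !near_simpl !near_withinE; apply: filterS => s sU s0.
  by apply: sU => /=; [rewrite gt_eqF | exact: ltW].
have : w 0 i 0 + s * ((s - 0)^-1 * (w s i 0 - w 0 i 0)) @[s --> 0^'+]
       --> w 0 i 0 + 0 * (M *m w 0) i 0.
  apply: cvgD; first exact: cvg_cst.
  by apply: cvgM q0; apply: cvg_at_right_filter; exact: cvg_id.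
rewrite mul0r addr0; apply: cvg_trans; apply: near_eq_cvg.
near=> s; rewrite subr0 mulVKf ?subrKC //.
Unshelve. all: end_near. Qed.

(** This feeds the extreme and mean value theorems. At 0 only the right limit is available, since
    the system constrains [w] only at non-negative times. *)
Lemma linear_ode_within_continuous (T : R) (i : 'I_n) : 0 < T ->
  {within `[0, T], continuous (fun s => w s i 0)}.
Proof.
have cw t : 0 < t -> {for t, continuous (fun s => w s i 0)}.
  move=> /(linear_ode_is_derive i) [/derivable1_diffP + _].
  exact: differentiable_continuous.
move=> T0; apply/continuous_within_itvP => //; split.
- by move=> t; rewrite in_itv /= => /andP[/cw].
- exact: linear_ode_cvg_at_right0.
- by apply: cvg_at_left_filter; exact: cw.
Qed.

End LinearSystem.

(** Difference quotients to the left of a minimum are non-positive. The one-sided form also covers a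
    minimum at the right end of an interval. *)
Lemma left_min_derive_le0 (R : realType) (f : R -> R) (c x a : R) :
  c < x -> is_derive x 1 f a -> (forall s, c <= s <= x -> f x <= f s) -> a <= 0.
Proof.
move=> cx /is_derive1_caratheodory [g [gE g_cont <-]] f_min.
apply: (cvgr_to_le (cvg_at_left_filter g_cont)).
near=> s.
have sx : s < x by near: s; exact: nbhs_left_lt.
have cs : c < s by near: s; exact: nbhs_left_gt.
rewrite -(nmulr_lge0 (x := s - x)); last by rewrite subr_lt0.
by rewrite -gE subr_ge0 f_min // !ltW.
Unshelve. all: end_near. Qed.

Lemma is_derive_expRM (R : realType) (f : R -> R) (k t a : R) :
  is_derive t 1 f a ->
  is_derive t 1 (fun s => expR (- k * s) * f s)
    (expR (- k * t) * (a - k * f t)).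
Proof.
move=> fa.
have ek : is_derive t 1 (fun s => expR (- k * s)) (- k * expR (- k * t)).
  by apply: is_derive_eq; rewrite /GRing.scale /= mulr1 mulrC.
apply: is_derive_eq.
by rewrite /GRing.scale /=; ring.
Qed.

Lemma expRM_within_continuous (R : realType) (f : R -> R) (k : R) (A : set R) :
  {within A, continuous f} ->
  {within A, continuous (fun s => expR (- k * s) * f s)}.
Proof.
move=> f_cont x; apply: cvgM (f_cont x).
apply: (@continuous_subspaceT _ _ A (fun s => expR (- k * s))) => s.
apply: continuous_comp; last exact: continuous_expR.
by apply: cvgMl_tmp; exact: cvg_id.
Qed.

(** * Positivity and norm of solutions *)

Section PositiveSolution.
Variables (R : realType) (n : nat) (M : 'M[R]_n) (w : R -> 'cV[R]_n).
Hypothesis w_sol : linear_ode_solution M w.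
Hypothesis M_ge0 : forall i j, i != j -> 0 <= M i j.
Hypothesis w0_ge0 : forall i, 0 <= w 0 i 0.

(* With [k] larger than every row sum of [M], a negative minimum over all
   coordinates and all times in [0, t] of the discounted solution
   [exp(- k s) w(s)] would be approached with a positive slope. *)
Lemma metzler_ode_ge0 (t : R) (i : 'I_n) : 0 <= t -> 0 <= w t i 0.
Proof.
rewrite le_eqVlt => /predU1P[<-//|t0].
pose k : R := 1 + \sum_i \sum_j `|M i j|.
have k_gt j : \sum_l M j l < k.
  apply: (@le_lt_trans _ _ (\sum_i \sum_j `|M i j|)); last by rewrite ltrDr.
  rewrite [leRHS](bigD1 j) //= ler_wpDr ?ler_sum // => [|l _].
    by apply: sumr_ge0 => l _; apply: sumr_ge0.
  exact: ler_norm.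
pose v j (s : R) : R := expR (- k * s) * w s j 0.
have /choice[c cP] j : exists c, c \in `[0, t] /\
    forall s, s \in `[0, t] -> v j c <= v j s.
  have w_cont := linear_ode_within_continuous w_sol (i := j) t0.
  have [c ct cmin] :=
    EVT_min (ltW t0) (expRM_within_continuous (k := k) w_cont).
  by exists c.
pose m j := v j (c j).
case: (@arg_minP _ _ _ i xpredT m) => // j _ jmin.
have v_ge l s : s \in `[0, t] -> m j <= v l s.
  by move=> st; apply: le_trans (jmin l isT) _; apply: (cP l).2.
have [m_ge0|m_lt0] := leP 0 (m j).
  rewrite -(pmulr_rge0 _ (expR_gt0 (- k * t))).
  by apply: le_trans m_ge0 (v_ge i t _); rewrite in_itv /= lexx ltW.
have [cj_itv _] := cP j.
have cj_gt0 : 0 < c j.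
  have : 0 <= c j by move: cj_itv; rewrite in_itv => /andP[].
  rewrite le_eqVlt => /predU1P[cj0|//].
  move: m_lt0; rewrite /m /v -cj0 mulr0 expR0 mul1r.
  by rewrite ltNge w0_ge0.
have := is_derive_expRM k (linear_ode_is_derive w_sol j cj_gt0).
move=> /(left_min_derive_le0 cj_gt0) slope.
have {}slope : \sum_l M j l * v l (c j) - k * m j <= 0.
  rewrite [leLHS](_ : _ =
    expR (- k * c j) * ((M *m w (c j)) j 0 - k * w (c j) j 0)).
    apply: slope => s /andP[s0 sc]; apply: (v_ge j).
    move: cj_itv; rewrite !in_itv /= s0 => /andP[_]; exact: le_trans.
  rewrite mulrBr mulrCA; congr (_ - _).
  by rewrite mxE mulr_sumr; apply: eq_bigr => l _; rewrite mulrCA.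
(* For [l != j], [M j l >= 0] allows [v l (c j)] to be replaced by the overall minimum [m j]. Both
   factors are negative, a contradiction. *)
have : (\sum_l M j l - k) * m j <= 0.
  apply: le_trans slope; rewrite mulrBl lerD2r mulr_suml.
  apply: ler_sum => l _; have [<-//|jl] := eqVneq j l.
  by rewrite ler_wpM2l ?M_ge0 ?v_ge.
by rewrite nmulr_lle0 // subr_ge0 leNgt k_gt.
Qed.

Lemma metzler_ode_l1norm (h : R) :
  (forall j, \sum_i M i j = h) ->
  forall t : R, 0 <= t -> l1norm (w t) = expR (h * t) * l1norm (w 0).
Proof.
move=> M_h t; have norm_w (s : R) : 0 <= s -> l1norm (w s) = \sum_i w s i 0.
  by move=> s0; apply: eq_bigr => i _; rewrite ger0_norm // metzler_ode_ge0.
rewrite le_eqVlt => /predU1P[<-|t0]; first by rewrite mulr0 expR0 mul1r.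
rewrite !norm_w //; last exact: ltW.
have dsum (s : R) : 0 < s ->
    is_derive s 1 (fun s => \sum_i w s i 0) (h * \sum_i w s i 0).
  move=> s0; have dw i := linear_ode_is_derive w_sol i s0.
  have -> : h * \sum_i w s i 0 = \sum_i (M *m w s) i 0.
    under [RHS]eq_bigr do rewrite mxE.
    rewrite exchange_big mulr_sumr /=; apply: eq_bigr => j _.
    by rewrite -mulr_suml M_h.
  have := is_derive_sum (h := fun i s => w s i 0) dw.
  by congr is_derive; apply/funext => u; rewrite fct_sumE.
have csum : {within `[0, t], continuous (fun s => \sum_i w s i 0)}.
  elim: (index_enum _) => [|i l IH].
    rewrite (_ : (fun _ => _) = cst 0); first exact: cst_continuous.
    by apply/funext => s; rewrite big_nil.
  rewrite (_ : (fun _ => _) = (fun s => w s i 0) \+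
     (fun s => \sum_(j <- l) w s j 0)).
    move=> s; apply: cvgD (IH s).
    exact: (linear_ode_within_continuous w_sol (i := i) t0).
  by apply/funext => s; rewrite big_cons.
(* The sum discounted at rate [h] has zero derivative, so its values at 0 and [t] agree. *)
have [|x xt] := MVT (f := fun s => expR (- h * s) * \sum_i w s i 0)
    (df := cst 0) t0 _ (expRM_within_continuous csum).
  move=> s; rewrite in_itv /= => /andP[/dsum /(is_derive_expRM h)].
  by rewrite subrr mulr0.
rewrite mul0r mulr0 expR0 mul1r => /subr0_eq <-.
by rewrite mulrA -expRD mulNr subrr expR0 mul1r.
Qed.

End PositiveSolution.

(** * Conjugation by [T] and the signs of the resulting entries *)

Lemma upper_ones_unit (R : realType) (S : nat) : upper_ones R S \in unitmx.
Proof.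
rewrite -unitmx_tr unitmxE det_trig; last first.
  by apply/is_trig_mxP => i j ij; rewrite !mxE leqNgt ij.
by rewrite big1 ?unitr1 // => i _; rewrite !mxE leqnn.
Qed.

Lemma invmx_diag_mx (F : fieldType) n (d : 'rV[F]_n) :
  (forall i, d 0 i != 0) -> invmx (diag_mx d) = diag_mx (\row_i (d 0 i)^-1).
Proof.
move=> d_neq0; have dV : diag_mx d *m diag_mx (\row_i (d 0 i)^-1) = 1%:M.
  rewrite mulmx_diag; apply/matrixP => i j; rewrite !mxE.
  by have [->|] := eqVneq i j; rewrite ?mulr0n // mulr1n divff.
have [d_unit _] := mulmx1_unit dV.
by rewrite -[LHS]mulmx1 -dV mulmxA mulVmx ?mul1mx.
Qed.

Lemma telescope_ord (R : zmodType) (S : nat) (f : 'I_S.+1 -> R) (j : 'I_S) :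
  \sum_(k < S | (k <= j)%N) (f (lift ord0 k) - f (widen_ord (leqnSn S) k)) =
  f (lift ord0 j) - f ord0.
Proof.
have liftE (k : 'I_S) : lift ord0 k = inord k.+1.
  by apply: val_inj; rewrite /= inordK // ltnS.
have widenE (k : 'I_S) : widen_ord (leqnSn S) k = inord k.
  by apply: val_inj; rewrite /= inordK // ltnW // ltnS.
under eq_bigr do rewrite liftE widenE.
rewrite (eq_bigl (fun k : 'I_S => (k < j.+1)%N)) //.
rewrite -(big_ord_widen _ (fun k => f (inord k.+1) - f (inord k))) //.
rewrite -(big_mkord xpredT (fun k => f (inord k.+1) - f (inord k))).
rewrite (telescope_sumr (fun k => f (inord k))) // liftE.
by congr (_ - f _); apply: val_inj; rewrite /= inordK.
Qed.

Section Conjugation.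
Variables (R : realType) (S : nat) (Q : 'M[R]_S.+1).

(** The index [k] codes the state [k + 1], that is [lift ord0 k]; this is the state just below
    it. *)
Let pred_state (k : 'I_S) : 'I_S.+1 := widen_ord (leqnSn S) k.

(* The closed form of [T B T^-1]. *)
Definition conj_reduced : 'M[R]_S :=
  \matrix_(i, k) \sum_(m < S | (i <= m)%N)
    (Q (lift ord0 k) (lift ord0 m) - Q (pred_state k) (lift ord0 m)).

(** Multiplying by [T] on the right sums the columns up to [j], which telescopes
    [q_(k,m) - q_(k-1,m)] to [q_(j,m) - q_(0,m)], an entry of [B]. *)
Lemma upper_ones_conj_reduced :
  upper_ones R S *m reduced_matrix Q^T = conj_reduced *m upper_ones R S.
Proof.
apply/matrixP => i j; rewrite !mxE.
under eq_bigr do rewrite !mxE mulr_natl mulrb.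
under [RHS]eq_bigr do rewrite !mxE mulr_natr mulrb.
rewrite -!big_mkcond /= exchange_big /=; apply: eq_bigr => m _.
by rewrite (telescope_ord (fun s => Q s (lift ord0 m))).
Qed.

Lemma Bstar2E (d : 'rV[R]_S) i k : (forall l, 0 < d 0 l) ->
  Bstar2 Q d i k = d 0 i * conj_reduced i k / d 0 k.
Proof.
move=> d_gt0; rewrite /Bstar2 -(mulmxA (diag_mx d)) upper_ones_conj_reduced.
rewrite mulmxA mulmxK ?upper_ones_unit // invmx_diag_mx; last first.
  by move=> l; rewrite gt_eqF.
by rewrite mul_mx_diag mul_diag_mx !mxE.
Qed.

Hypothesis Q_inf : infinitesimal_matrix Q.

Lemma conj_reduced_lower i k :
  conj_reduced i k = \sum_(s < S.+1 | (s <= i)%N)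
    (Q (pred_state k) s - Q (lift ord0 k) s).
Proof.
have row0 j : \sum_s Q j s = 0.
  by rewrite (bigD1 j) //= Q_inf.2 addNr.
(* An index [m >= i] codes the state [m + 1 > i], hence the complement of the states [s <= i]. *)
have upperE : conj_reduced i k = \sum_(s < S.+1 | ~~ (s <= i)%N)
    (Q (lift ord0 k) s - Q (pred_state k) s).
  rewrite mxE [RHS]big_mkcond big_ord_recl /= add0r [LHS]big_mkcond /=.
  by apply: eq_bigr => m _; rewrite -ltnNge /bump add1n ltnS.
have : \sum_s (Q (lift ord0 k) s - Q (pred_state k) s) = 0.
  by rewrite sumrB !row0 subrr.
rewrite (bigID (fun s : 'I_S.+1 => (s <= i)%N)) /= -upperE addrC.
move/eqP; rewrite addr_eq0 => /eqP ->; rewrite -sumrN.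
by apply: eq_bigr => s _; rewrite opprB.
Qed.

Hypothesis Q_regular : regular_infinitesimal_matrix Q.

(** On either side of the diagonal, the chosen form of the sum avoids the diagonal of [Q], so
    regularity applies to each term. *)
Lemma conj_reduced_ge0 i k : i != k -> 0 <= conj_reduced i k.
Proof.
move=> ik; have [i_lt_k|k_lt_i|/val_inj/eqP] := ltngtP i k.
- rewrite conj_reduced_lower; apply: sumr_ge0 => s s_le_i; rewrite subr_ge0.
  by apply: (Q_regular s).2; rewrite /= /bump; lia.
- rewrite mxE; apply: sumr_ge0 => m i_le_m; rewrite subr_ge0.
  by apply: (Q_regular (lift ord0 m)).1; rewrite /= /bump; lia.
- by rewrite (negbTE ik).
Qed.

(** This is what the four classes have in common: on either side, rates into a state are strictly
    smaller from distance 2 than from distance 1. *)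
Hypothesis Q_strict : forall i j l : 'I_S.+1,
  j = i.+1 :> nat -> l = i.+2 :> nat -> Q i l < Q j l /\ Q l i < Q j i.

(** One summand, at the state [i] in the first sum and [lift ord0 j] in the second, compares
    distances 1 and 2 and is strictly positive. *)
Lemma conj_reduced_adjacent_gt0 (i j : 'I_S) : i.+1 = j ->
  0 < conj_reduced i j /\ 0 < conj_reduced j i.
Proof.
move=> ij; split.
- rewrite conj_reduced_lower (bigD1 (pred_state i)) //= ltr_wpDr //.
    apply: sumr_ge0 => s /andP[s_le_i _]; rewrite subr_ge0.
    by apply: (Q_regular s).2; rewrite /= /bump; lia.
  rewrite subr_gt0; apply: (Q_strict _ _).2; rewrite /= /bump; lia.
- rewrite mxE (bigD1 j) //= ltr_wpDr //.
    apply: sumr_ge0 => m /andP[j_le_m _]; rewrite subr_ge0.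
    by apply: (Q_regular (lift ord0 m)).1; rewrite /= /bump; lia.
  rewrite subr_gt0; apply: (Q_strict _ _).1; rewrite /= /bump; lia.
Qed.

End Conjugation.

(** * Equal column sums and the conclusion *)

Lemma column_sum_extrema (R : realType) (S : nat) (S_gt0 : (0 < S)%N)
    (M : 'M[R]_S) (h : R) :
  (forall k, column_sum M k = h) ->
  max_column_sum S_gt0 M = h /\ min_column_sum S_gt0 M = h.
Proof.
move=> M_h; rewrite /max_column_sum /min_column_sum.
by split; elim/big_rec: _ => // k x _ ->; rewrite M_h ?maxxx ?minxx.
Qed.

Theorem theorem3 (R : realType) (S : nat) (S_gt0 : (0 < S)%N)
    (disp : measure_display) (Omega : measurableType disp)
    (P : probability Omega R) (X : R -> Omega -> 'I_S.+1) (Q : 'M[R]_S.+1)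
    (Q_inf : infinitesimal_matrix Q)
    (X_chain : homogeneous_markov_chain P X Q)
    (Q_regular : regular_infinitesimal_matrix Q)
    (X_class :
      [\/ exists lam mu : nat -> R, birth_death Q^T lam mu /\
            (forall i, (i < S)%N -> 0 < lam i /\ 0 < mu i.+1),
          exists a mu : nat -> R, batch_births_single_deaths Q^T a mu /\
            (forall i, (i < S)%N -> 0 < mu i.+1) /\
            (2 <= S)%N /\ a 2%N < a 1%N,
          exists b lam : nat -> R, batch_deaths_single_births Q^T b lam /\
            (forall i, (i < S)%N -> 0 < lam i) /\
            (2 <= S)%N /\ b 2%N < b 1%N |
          exists a b : nat -> R, batch_births_batch_deaths Q^T a b /\
            (2 <= S)%N /\ a 2%N < a 1%N /\ b 2%N < b 1%N]) :
  exists d : 'rV[R]_S,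
    (forall i, 0 < d 0 i) /\
    max_column_sum S_gt0 (Bstar2 Q d) = min_column_sum S_gt0 (Bstar2 Q d) /\
    (forall w : R -> 'cV[R]_S,
      linear_ode_solution (Bstar2 Q d) w ->
      (forall i, 0 <= w 0 i 0) ->
      forall t : R, 0 <= t ->
        l1norm (w t) =
        expR (min_column_sum S_gt0 (Bstar2 Q d) * t) * l1norm (w 0)).
Proof.
(* Where jumps are single, the rate at distance 2 is 0 and the one at distance 1 positive; where
   they come in batches, the claim is [a_2 < a_1] or [b_2 < b_1]. *)
have Q_strict (i j l : 'I_S.+1) : j = i.+1 :> nat -> l = i.+2 :> nat ->
    Q i l < Q j l /\ Q l i < Q j i.
  move=> ji li; have lj : l = j.+1 :> nat by rewrite ji.
  have iS : (i < S)%N by have := ltn_ord l; lia.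
  have jS : (j < S)%N by have := ltn_ord l; lia.
  have AE a b : Q a b = Q^T b a by rewrite mxE.
  have li2 : l = (i + 2)%N :> nat by lia.
  have lj1 : l = (j + 1)%N :> nat by lia.
  have ji1 : j = (i + 1)%N :> nat by lia.
  rewrite !AE; case: X_class.
  - case=> lam [mu [[A0 Amu Alam] pos]].
    rewrite (Alam j l) // (Amu i j) // !A0 ?li ?ltnSn ?orbT //.
    by split; [case: (pos j jS) | case: (pos i iS)].
  - case=> a [mu [[A0 Aa Amu _] [pos [S2 a21]]]].
    rewrite (Aa i l 2%N) // (Aa j l 1%N) // (Amu i j) // A0 ?li //.
    by split => //; exact: pos.
  - case=> b [lam [[A0 Ab Alam _] [pos [S2 b21]]]].
    rewrite (Alam j l) // (Ab i l 2%N) // (Ab i j 1%N) // A0 ?li //.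
    by split => //; exact: pos.
  - case=> a [b [[Aa Ab _ _] [S2 [a21 b21]]]].
    by rewrite (Aa i l 2%N) // (Aa j l 1%N) // (Ab i l 2%N) // (Ab i j 1%N).
have [d [h [d_gt0 dh]]] := metzler_left_perron_vector S_gt0
  (conj_reduced_ge0 Q_inf Q_regular)
  (conj_reduced_adjacent_gt0 Q_inf Q_regular Q_strict).
(* This is coordinate [k] of the eigenvector equation divided by [d 0 k]. *)
have B_h k : column_sum (Bstar2 Q d) k = h.
  have /rowP/(_ k) := dh; rewrite !mxE => dhk.
  rewrite /column_sum; under eq_bigr do rewrite Bstar2E //.
  by rewrite -mulr_suml dhk mulfK // gt_eqF.
exists d; split => //; have [-> ->] := column_sum_extrema S_gt0 B_h.
split => // w w_sol w0.
apply: (metzler_ode_l1norm w_sol) => // i j ij.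
rewrite Bstar2E // divr_ge0 ?mulr_ge0 //; try exact: ltW.
exact: (conj_reduced_ge0 Q_inf Q_regular ij).
Qed.
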